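(* Let $0<s\le1/2$. Let $T$ be a Calderón-Zygmund singular integral operator of weak-type $(1,1)$, with kernel $k$, such that for a Young function $A$, every cube $Q$, and all $u,v\in Q$, $$\sum_{m=1}^\infty|2^{m+1}Q|\,\big\|\mathbf{1}_{2^{m+1}Q\setminus2^mQ}\,\big(k(u,\cdot)-k(v,\cdot)\big)\big\|_{L^A(2^{m+1}Q)}\le c_A<\infty.$$ Then, with $c$ independent of $x$, $Q_0$, and $f$, for every cube $Q_0$ and $x\in Q_0$, $$M^{\sharp}_{0,s,Q_0}(Tf)(x)\le c\sup_{x\in Q,\,Q\subset Q_0}\ \inf_{y\in Q}M_{\overline{A}}f(y).$$
   Context: All cubes have sides parallel to the axes; $\lambda Q$ is the cube concentric with $Q$ with sidelength multiplied by $\lambda$. $T$ is given by $Tf(x)=\mathrm{p.v.}\int_{\mathbb{R}^n}k(x,y)f(y)\,dy$. A continuous function $A$ on $[0,\infty)$ satisfies condition $C$ if it is increasing, $A(0)=0$, and $A(2t)\le c\,A(t)$ for all $t>0$; a function satisfying condition $C$ which is convex and such that $A(t)\to\infty$ as $t\to\infty$ (or, more generally, such that $A(t)/t\to\infty$ as $t\to\infty$) is called a Young function. Its conjugate is $\overline{A}(t)=\sup_{s>0}(st-A(s))$. For a Young function $A$, $$\|f\|_{L^A(Q)}=\inf\Big\{\lambda>0:\frac{1}{|Q|}\int_QA\Big(\frac{|f(y)|}{\lambda}\Big)dy\le1\Big\},\qquad M_Af(x)=\sup_{x\in Q}\|f\|_{L^A(Q)}.$$ The local sharp maximal function restricted to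 $Q_0$ is $$M^{\sharp}_{0,s,Q_0}g(x)=\sup_{x\in Q,\,Q\subset Q_0}\ \inf_c\ \inf\{\alpha\ge0:|\{y\in Q:|g(y)-c|>\alpha\}|<s|Q|\}\quad(x\in Q_0),$$ with supremum over cubes $Q$. *)

(* Defs.v *)
From HB Require Import structures.
From mathcomp Require Import all_boot all_order all_algebra.
From mathcomp Require Import all_classical all_reals all_analysis.
From mathcomp Require Import ring.

Set Implicit Arguments.
Unset Strict Implicit.
Unset Printing Implicit Defensive.

Import Order.TTheory GRing.Theory Num.Theory.
Import numFieldNormedType.Exports.

Local Open Scope classical_set_scope.
Local Open Scope ring_scope.

Lemma product_sigma_finite d1 d2 (T1 : measurableType d1)
    (T2 : measurableType d2) (R : realType)
    (m1 : {sigma_finite_measure set T1 -> \bar R})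
    (m2 : {sigma_finite_measure set T2 -> \bar R}) :
  sigma_finite setT (m1 \x m2)%E.
Proof.
have /sigma_finiteP[F [TF ndF Foo]] := sigma_finiteT m1.
have /sigma_finiteP[G [TG ndG Goo]] := sigma_finiteT m2.
exists (fun n => F n `*` G n) => [|k].
  rewrite -setXTT TF TG predeqE => -[x y]; split.
    move=> [/= [n _ Fnx] [k _ Gky]]; exists (maxn n k) => //; split.
    - by move: x Fnx; exact/subsetPset/ndF/leq_maxl.
    - by move: y Gky; exact/subsetPset/ndG/leq_maxr.
  by move=> [n _ []/= ? ?]; split; exists n.
have [mF Fk] := Foo k; have [mG Gk] := Goo k.
split; first exact: measurableX.
by rewrite product_measure1E// lte_mul_pinfty// ge0_fin_numE.
Qed.

(* Lebesgue measure on the Borel sets of R^n: the iterated product of the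
   one-dimensional Lebesgue measure, transported along R x R^n = R^(n+1). *)
Section borel_lebesgue.
Variable R : realType.
Local Notation BR := (measurableTypeR R).

Section step.
Variables (n : nat) (mu : {sigma_finite_measure set (n.-tuple BR) -> \bar R}).

Definition tuple_of_pair (p : BR * n.-tuple BR) : n.+1.-tuple BR :=
  [the n.+1.-tuple BR of p.1 :: p.2].

Lemma measurable_tuple_of_pair : measurable_fun setT tuple_of_pair.
Proof. exact: (measurable_cons measurable_fst measurable_snd). Qed.

HB.instance Definition _ := isMeasurableFun.Build _ _ _ _ tuple_of_pair
  measurable_tuple_of_pair.

Definition lebesgue_step : set (n.+1.-tuple BR) -> \bar R :=
  pushforward (@lebesgue_measure R \x mu)%E tuple_of_pair.

Let lebesgue_step0 : lebesgue_step set0 = 0%E.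
Proof. exact: measure0. Qed.

Let lebesgue_step_ge0 A : (0 <= lebesgue_step A)%E.
Proof. exact: measure_ge0. Qed.

Let lebesgue_step_sigma_additive : semi_sigma_additive lebesgue_step.
Proof. exact: measure_semi_sigma_additive. Qed.

HB.instance Definition _ := isMeasure.Build _ _ _ lebesgue_step
  lebesgue_step0 lebesgue_step_ge0 lebesgue_step_sigma_additive.

Let lebesgue_step_sigma_finite : sigma_finite setT lebesgue_step.
Proof.
have [F FT Ffin] := product_sigma_finite (@lebesgue_measure R) mu.
pose g (t : n.+1.-tuple BR) : BR * n.-tuple BR := (thead t, [tuple of behead t]).
have gK : cancel tuple_of_pair g.
  by case=> a t; rewrite /g/= theadE; congr pair; exact/val_inj.
have mg : measurable_fun setT g.
  apply/measurable_fun_pairP; split => /=; first exact: measurable_tnth.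
  exact: measurable_behead.
exists (fun i => g @^-1` F i).
  by rewrite -preimage_bigcup -FT preimage_setT.
move=> i; have [mFi Fioo] := Ffin i; split.
  by rewrite -[X in measurable X]setTI; exact: mg.
rewrite /lebesgue_step /pushforward -comp_preimage.
by rewrite (_ : g \o tuple_of_pair = id)//; exact/funext.
Qed.

HB.instance Definition _ := Measure_isSigmaFinite.Build _ _ _ lebesgue_step
  lebesgue_step_sigma_finite.

End step.

Section base.
Definition lebesgue0 : set (0.-tuple BR) -> \bar R := \d_([tuple]).

HB.instance Definition _ := Measure.on lebesgue0.

Let lebesgue0_sigma_finite : sigma_finite setT lebesgue0.
Proof.
by apply: fin_num_fun_sigma_finite => [|A mA]; rewrite /lebesgue0 diracE ?ltry.
Qed.

HB.instance Definition _ := Measure_isSigmaFinite.Build _ _ _ lebesgue0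
  lebesgue0_sigma_finite.
End base.

Fixpoint borel_lebesgue n : {sigma_finite_measure set (n.-tuple BR) -> \bar R} :=
  match n with
  | 0 => lebesgue0
  | m.+1 => lebesgue_step (borel_lebesgue m)
  end.

End borel_lebesgue.

Lemma measurable_box (R : realType) n (I : 'I_n -> set (measurableTypeR R)) :
  (forall i, measurable (I i)) ->
  measurable [set t : n.-tuple (measurableTypeR R) | forall i, I i (tnth t i)].
Proof.
move=> mI.
have -> : [set t : n.-tuple (measurableTypeR R) | forall i, I i (tnth t i)] =
  \bigcap_(i in [set: 'I_n]) ((fun t => tnth t i) @^-1` I i).
  apply/seteqP; split=> t /= H i; [by move=> _; exact: H|exact: H].
apply: fin_bigcap_measurable => // i _.
by rewrite -[X in measurable X]setTI; exact: measurable_tnth.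
Qed.

Lemma borel_lebesgue_box (R : realType) n (I : 'I_n -> set (measurableTypeR R)) :
  (forall i, measurable (I i)) ->
  borel_lebesgue R n [set t | forall i, I i (tnth t i)] =
  (\prod_(i < n) lebesgue_measure (I i))%E.
Proof.
elim: n I => [|n IH] I mI /=.
  by rewrite big_ord0 /lebesgue0 diracE mem_set//= => -[].
rewrite big_ord_recl -IH//= /lebesgue_step /pushforward -product_measure1E//.
  congr product_measure1; apply/seteqP; split=> -[a t] /=.
    move=> H; split; first exact: (H ord0).
    by move=> i; have := H (lift ord0 i); rewrite tnthS.
  move=> [H0 H] i; case: (unliftP ord0 i) => [j ->|->]//.
  by rewrite tnthS.
by apply: (@measurable_box _ _ (fun i => I (lift ord0 i))) => i; exact: mI.
Qed.

(* R^n with its Lebesgue sigma-algebra *)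
Definition Rn (R : realType) (n : nat) :=
  caratheodory_type (mu_ext (borel_lebesgue R n)).

HB.instance Definition _ (R : realType) (n : nat) := Measurable.on (Rn R n).

(* On a set that is not Lebesgue measurable, vol is the Lebesgue outer
   measure. *)
Definition vol {R : realType} {n : nat} : set (Rn R n) -> \bar R :=
  @completed_measure_extension _ _ _ (borel_lebesgue R n).

HB.instance Definition _ (R : realType) (n : nat) := Measure.on (@vol R n).

Section cubes.
Context {R : realType} {n : nat}.
Implicit Types (x a : Rn R n) (l : R).

Definition pcoord x (i : 'I_n) : R := tnth (x : n.-tuple R) i.

Definition eucl_dist x y : R :=
  Num.sqrt (\sum_(i < n) (pcoord x i - pcoord y i) ^+ 2).

(* Closed cube with centre a and sidelength l; its dilate by m > 0 is
   cube a (m * l). *)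
Definition cube a l : set (Rn R n) :=
  [set x | forall i, `|pcoord x i - pcoord a i| <= l / 2].

Definition is_cube (Q : set (Rn R n)) :=
  exists a l, 0 < l /\ Q = cube a l.

End cubes.

Lemma vol_cube (R : realType) (n : nat) (a : Rn R n) (l : R) : 0 < l ->
  measurable (cube a l) /\ vol (cube a l) = (l ^+ n)%:E.
Proof.
move=> l0.
pose I i : set (measurableTypeR R) := `[pcoord a i - l / 2, pcoord a i + l / 2]%classic.
have -> : cube a l = [set t : n.-tuple (measurableTypeR R) | forall i, I i (tnth t i)].
  by apply/seteqP; split=> t /= H i; have := H i; rewrite /I /= in_itv/= ler_distl.
have mI i : measurable (I i) by exact: measurable_itv.
split.
  by apply: sub_caratheodory; apply: sub_sigma_algebra; exact: measurable_box.
rewrite /vol /completed_measure_extension measurable_mu_extE; last exact: measurable_box.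
apply: (etrans (borel_lebesgue_box mI)).
rewrite (eq_bigr (fun=> l%:E)) => [|i _].
  by rewrite big_const_ord; elim: n {I mI a} => //= n ->; rewrite exprS EFinM.
by rewrite lebesgue_measure_itv/= lte_fin ltrD2l gtrN ?divr_gt0// EFinD -EFinB; congr EFin; field.
Qed.

Section young.
Context {R : realType}.
Implicit Types A : R -> R.

(* Only the values of A on [0, +oo[ are relevant. *)
Definition conditionC A :=
  [/\ {within `[0, +oo[, continuous A},
      {in `[0, +oo[ &, {homo A : t u / t <= u}},
      A 0 = 0 &
      exists c : R, forall t, 0 < t -> A (2 * t) <= c * A t].

Definition young A :=
  conditionC A /\
  ((convex_function (`[0, +oo[ : set R^o) A /\ A t @[t --> +oo] --> +oo) \/
   A t / t @[t --> +oo] --> +oo).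

(* Extended valued: for A(t) = t the conjugate is +oo on ]1, +oo[. *)
Definition young_conj A (t : R) : \bar R :=
  ereal_sup [set (s * t - A s)%:E | s in [set s : R | 0 < s]].

End young.

Section maximal.
Context {R : realType} {n : nat}.
Local Notation X := (Rn R n).
Local Open Scope ereal_scope.
Implicit Types (B : R -> \bar R) (f g : X -> R) (Q : set X) (x : X).

Definition luxemburg B Q f : \bar R :=
  ereal_inf [set r%:E | r in [set r : R | (0 < r)%R /\
    ((fine (vol Q))^-1)%:E * \int[vol]_(y in Q) B (`|f y| / r)%R <= 1]].

Definition maximal B f x : \bar R :=
  ereal_sup [set luxemburg B Q f | Q in [set Q | is_cube Q /\ Q x]].

Definition local_sharp (s : R) (Q0 : set X) g x : \bar R :=
  ereal_sup [set
      ereal_inf [set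
          ereal_inf [set alpha%:E | alpha in [set alpha : R | (0 <= alpha)%R /\
            vol (Q `&` [set y | (alpha < `|g y - c|)%R]) < s%:E * vol Q]]
        | c in [set: R]]
    | Q in [set Q | [/\ is_cube Q, Q x & Q `<=` Q0]]].

End maximal.

Section singular_integral.
Context {R : realType} {n : nat}.
Local Notation X := (Rn R n).
Implicit Types (k : X -> X -> R) (f : X -> R) (x : X).

Definition truncated k f x (e : R) : R :=
  \int[vol]_(y in [set y | e < eucl_dist x y]) (k x y * f y).

Definition pv k f x : R := lim (truncated k f x e @[e --> 0^'+]).

Definition pv_exists k f x :=
  (forall e : R, 0 < e ->
    vol.-integrable [set y | e < eucl_dist x y] (fun y => (k x y * f y)%:E)) /\
  cvg (truncated k f x e @[e --> 0^'+]).

(* T f is well defined: the principal value exists almost everywhere. *)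
Definition pv_defined k f :=
  measurable_fun setT f /\ {ae vol, forall x, pv_exists k f x}.

Definition weak_type_11 (T : (X -> R) -> X -> R) :=
  exists C : R, forall f, vol.-integrable setT (EFin \o f) ->
    forall t : R, 0 < t ->
      (vol [set x | (t < `|T f x|)%R] <=
       (C / t)%:E * \int[vol]_x `|f x|%:E)%E.

(* T = pv k is defined on L^1 and of weak type (1, 1). *)
Definition singular_integral_weak11 k :=
  [/\ forall x, measurable_fun setT (k x),
      forall f, vol.-integrable setT (EFin \o f) -> pv_defined k f &
      weak_type_11 (pv k)].

Definition kernel_condition (A : R -> R) k :=
  exists cA : R, forall (a : X) (l : R), 0 < l ->
    forall u v, cube a l u -> cube a l v ->
    (\sum_(1 <= m <oo)
       vol (cube a (2 ^+ m.+1 * l)) *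
       luxemburg (EFin \o A) (cube a (2 ^+ m.+1 * l))
         (fun y => \1_(cube a (2 ^+ m.+1 * l) `\` cube a (2 ^+ m * l)) y *
                   (k u y - k v y))%R
     <= cA%:E)%E.

End singular_integral.

(* Main.v *)
Require Import Defs.
From HB Require Import structures.
From mathcomp Require Import all_boot all_order all_algebra.
From mathcomp Require Import all_classical all_reals all_analysis.
From mathcomp Require Import measurable_realfun.
From mathcomp Require Import ring lra.

(**
Why the theorem is true.  Fix a cube Q containing x, inside Q0, with centre a
and side l, and a number K exceeding the maximal function of f at some point
y of Q.  Every dilate L Q with L >= 1 contains y, so by the definition of the
Luxemburg norm the conjugate modular of f / K has average at most 1 on each
of these dilates.  This one property of f controls both parts of the splitting
f = f1 + f2, where f1 is the restriction of f to 2Q.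

The near part.  Young's inequality against the constant 1 bounds the integral
of |f| over 2Q by a multiple of K |Q|, so f1 is integrable and the weak type
(1,1) estimate makes |T f1| exceed D K only on a set of measure < s |Q|, for a
suitable constant D ([weak_type_near_part]).

The far part.  Around any v in Q the small truncations leave the complement of
2Q intact, whence for almost every v T f(v) = T f1(v) + F(v), F(v) being the absolutely
convergent integral of k(v,.) f over that complement ([pv_near_far]).  The
complement of 2Q is the disjoint union of the dyadic annuli; Young's
inequality on each one, with the Luxemburg norm of the kernel difference on
one side and K on the other, gives |F(u) - F(v)| <= 2 K cA by the hypothesis
on the kernel ([integral_kernel_diff_le]).

Hence, subtracting the constant F(u) for one good point u of Q, |T f - F(u)| is
at most (D + 2 cA) K on Q outside a set of measure < s |Q| ([oscillation_lt]).
Letting K decrease to the maximal function at y, then taking the infimum over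
y and the supremum over Q, finishes the proof.
*)

Set Implicit Arguments.
Unset Strict Implicit.
Unset Printing Implicit Defensive.

Import Order.TTheory GRing.Theory Num.Theory.
Import numFieldNormedType.Exports.

Local Open Scope classical_set_scope.
Local Open Scope ring_scope.

(** * Young functions, their conjugates and measurability *)

Section young_facts.
Context {R : realType}.
Variables (A : R -> R) (hA : conditionC A).

Lemma conditionC_ge0 t : 0 <= t -> 0 <= A t.
Proof.
case: hA => _ nd A0 _ t0; rewrite -A0.
by apply: nd; rewrite // in_itv/= ?lexx ?andbT.
Qed.

Lemma conditionC_right_cvg0 : A t @[t --> 0^'+] --> 0.
Proof.
case: hA => cA _ A0 _; rewrite -[X in _ --> X]A0.
by move/continuous_within_itvcyP : cA => [].
Qed.

(** The quantity s t - A(s), whose supremum over s > 0 is the conjugate, tends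
    to 0 with s. *)
Lemma young_conj_ge0 t : (0 <= young_conj A t)%E.
Proof.
apply/lee_addgt0Pr => e e0.
have sA : s * t - A s @[s --> 0^'+] --> 0.
  rewrite [X in _ --> X](_ : 0 = 0 * t - 0); last by rewrite mul0r subr0.
  apply: cvgB; last exact: conditionC_right_cvg0.
  by apply: cvgMl; apply: cvg_at_right_filter; exact: cvg_id.
have : \forall s \near 0^'+, - e < s * t - A s.
  by apply: (cvgr_gt _ sA); rewrite oppr_lt0.
have : \forall s \near (0:R)^'+, 0 < s by exact: nbhs_right_gt.
move=> H1 H2; have [s [s0 hs]] : exists s, 0 < s /\ - e < s * t - A s.
  by apply: (@filter_ex _ (0^'+ : set_system R)); near=> s; split; near: s.
apply: (@le_trans _ _ ((s * t - A s)%:E + e%:E)%E).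
  by rewrite -EFinD lee_fin; lra.
by rewrite leeD2r//; apply: ereal_sup_ubound; exists s.
Unshelve. all: by end_near. Qed.

(** For s > 0 this is the definition of the conjugate; at s = 0, a value that
    its supremum leaves out, it is the nonnegativity of the conjugate. *)
Lemma young_inequality s t : 0 <= s ->
  ((s * t)%:E <= (A s)%:E + young_conj A t)%E.
Proof.
rewrite le_eqVlt => /predU1P[<-|s0].
  by rewrite mul0r adde_ge0 ?young_conj_ge0// lee_fin conditionC_ge0.
rewrite -leeBlDl// -EFinB.
by apply: ereal_sup_ubound; exists s.
Qed.

(** A may be arbitrary on the negative half-line, so it is replaced by the
    function t |-> A (max t 0), which is monotone on the whole line. *)
Lemma measurable_conditionC_norm d (T : measurableType d) (D : set T)
    (g : T -> R) (r : R) : measurable_fun D g -> 0 < r ->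
  measurable_fun D (fun y => A (`|g y| / r)).
Proof.
move=> mg r0.
rewrite (_ : (fun y => _) = (fun t => A (Num.max t 0)) \o
    (fun y => `|g y| / r)); last first.
  apply/funext => y /=; congr A; rewrite max_l//.
  by rewrite divr_ge0// ltW.
apply: measurableT_comp.
  apply: nondecreasing_measurable => // t u tu.
  case: hA => _ nd _ _; apply: nd; rewrite ?in_itv/= ?andbT.
  - by rewrite le_max lexx orbT.
  - by rewrite le_max lexx orbT.
  - by rewrite ge_max !le_max tu lexx orbT.
apply: measurable_funM => //.
exact: measurableT_comp.
Qed.

End young_facts.

Lemma young_conj_homo (R : realType) (A : R -> R) :
  {homo young_conj A : t u / t <= u >-> (t <= u)%E}.
Proof.
move=> t u tu; apply/ereal_supP => _ [s /= s0 <-].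
apply: le_ereal_sup_tmp; exists (s * u - A s)%:E; first by exists s.
by rewrite lee_fin lerB// ler_wpM2l// ltW.
Qed.

Lemma measurable_young_conj (R : realType) (A : R -> R) :
  measurable_fun setT (young_conj A).
Proof.
apply: (measurability (@ErealGenCInfty.G R)) => [|/= _ [_] [r] -> <-].
  exact: ErealGenCInfty.measurableE.
apply: measurableI => //; apply: is_interval_measurable => s t/= fs ft u.
move=> /andP[su ut].
move: fs; rewrite !in_itv/= !andbT => /le_trans; apply.
exact: young_conj_homo.
Qed.

Lemma measurable_young_conj_norm (R : realType) (A : R -> R) d
    (T : measurableType d) (D : set T) (f : T -> R) (K : R) :
  measurable_fun D f ->
  measurable_fun D (fun y => young_conj A (`|f y| / K)).
Proof.
move=> mf; apply: (measurableT_comp (measurable_young_conj A)).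
by apply: measurable_funM => //; exact: measurableT_comp.
Qed.

(** * Hoelder's inequality in Luxemburg form *)

(** Young's inequality applied to |g| / r and |f| / K, integrated. *)
Lemma integral_normM_le_young (R : realType) (A : R -> R) d
    (T : measurableType d) (mu : {measure set T -> \bar R}) (D : set T)
    (g f : T -> R) (r K : R) (a b : \bar R) : conditionC A ->
  measurable D -> measurable_fun D g -> measurable_fun D f -> 0 < r -> 0 < K ->
  (\int[mu]_(y in D) (A (`|g y| / r))%:E <= a)%E ->
  (\int[mu]_(y in D) young_conj A (`|f y| / K) <= b)%E ->
  (\int[mu]_(y in D) `|g y * f y|%:E <= (r * K)%:E * (a + b))%E.
Proof.
move=> hA mD mg mf r0 K0 ha hb.
have mA : measurable_fun D (fun y => A (`|g y| / r)).
  exact: measurable_conditionC_norm.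
have mB : measurable_fun D (fun y => young_conj A (`|f y| / K)).
  exact: measurable_young_conj_norm.
have gr0 y : 0 <= `|g y| / r by rewrite divr_ge0// ltW.
rewrite (_ : (\int[mu]_(y in D) _)%E =
    (\int[mu]_(y in D) ((r * K)%:E * (`|g y| / r * (`|f y| / K))%:E))%E); last first.
  apply: eq_integral => y _; rewrite -EFinM; congr EFin.
  rewrite normrM; field.
  by rewrite !gt_eqF.
rewrite ge0_integralZl//=; last 3 first.
- apply/measurable_EFinP; apply: measurable_funM; apply: measurable_funM => //;
    exact: measurableT_comp.
- by move=> y _; rewrite lee_fin mulr_ge0// divr_ge0// ltW.
- by rewrite lee_fin mulr_ge0// ltW.
rewrite lee_pmul2l//; last by rewrite lte_fin mulr_gt0.
apply: le_trans (leeD ha hb).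
rewrite -ge0_integralD//=; last 3 first.
- by move=> y _; rewrite lee_fin conditionC_ge0.
- exact/measurable_EFinP.
- by move=> y _; exact: young_conj_ge0.
apply: ge0_le_integral => //=.
- by move=> y _; rewrite lee_fin mulr_ge0// divr_ge0// ltW.
- apply/measurable_EFinP; apply: measurable_funM; apply: measurable_funM => //;
    exact: measurableT_comp.
- by apply: emeasurable_funD => //; exact/measurable_EFinP.
- by move=> y _; exact: young_inequality.
Qed.

Lemma le_mule_ereal_inf (R : realType) (c : R) (x : \bar R) (S : set (\bar R)) :
  0 < c -> (forall y, S y -> (x <= c%:E * y)%E) -> (x <= c%:E * ereal_inf S)%E.
Proof.
move=> c0 xS; rewrite -lee_pdivrMl//; apply/ereal_infP => y Sy.
by rewrite lee_pdivrMl//; exact: xS.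
Qed.

Lemma luxemburg_ge0 (R : realType) (n : nat) (B : R -> \bar R)
    (Q : set (Rn R n)) (f : Rn R n -> R) : (0 <= luxemburg B Q f)%E.
Proof. by apply/ereal_infP => _ [r [/= r0 _] <-]; rewrite lee_fin ltW. Qed.

Section cube_integrals.
Context {R : realType} {n : nat}.
Local Notation X := (Rn R n).
Variables (A : R -> R) (hA : conditionC A).
Implicit Types (a : X) (l K : R) (f g : X -> R).

Lemma fine_vol_cube_gt0 a l : 0 < l -> 0 < fine (vol (cube a l)).
Proof. by move=> l0; rewrite (vol_cube a l0).2 exprn_gt0. Qed.

Lemma vol_cube_fineK a l : 0 < l ->
  (fine (vol (cube a l)))%:E = vol (cube a l).
Proof. by move=> l0; rewrite (vol_cube a l0).2. Qed.

(** The infimum defining the Luxemburg norm is exceeded by K, so some admissible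
    r is smaller than K; the modular decreases when r is enlarged to K. *)
Lemma lt_luxemburg_young_conj a l K f : 0 < l -> measurable_fun setT f ->
  (luxemburg (young_conj A) (cube a l) f < K%:E)%E ->
  (\int[vol]_(y in cube a l) young_conj A (`|f y| / K) <= vol (cube a l))%E.
Proof.
move=> l0 mf /ereal_inf_ltP[_ [r [/= r0 hr] <-]]; rewrite lte_fin => rK.
have v0 := fine_vol_cube_gt0 a l0.
move: hr; rewrite lee_pdivrMl// mule1 vol_cube_fineK//; apply: le_trans.
apply: ge0_le_integral.
- exact: (vol_cube a l0).1.
- by move=> y _; exact: young_conj_ge0.
- by apply: measurable_young_conj_norm; exact: measurable_funS mf.
- by apply: measurable_young_conj_norm; exact: measurable_funS mf.
- move=> y _; apply: young_conj_homo.
  rewrite ler_wpM2l// lef_pV2 ?posrE//; first exact: ltW.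
  exact: lt_trans rK.
Qed.

(** Hoelder's inequality: the constant 2 comes from adding the two modulars, each
    at most the volume of the cube.  It holds for every admissible r in the
    Luxemburg norm of g, hence for the infimum. *)
Lemma integral_normM_le_luxemburg a l K g f : 0 < l -> 0 < K ->
  measurable_fun setT g -> measurable_fun setT f ->
  (\int[vol]_(y in cube a l) young_conj A (`|f y| / K) <= vol (cube a l))%E ->
  (\int[vol]_(y in cube a l) `|g y * f y|%:E <=
   (2 * K)%:E * (vol (cube a l) * luxemburg (EFin \o A) (cube a l) g))%E.
Proof.
move=> l0 K0 mg mf hf; have v0 := fine_vol_cube_gt0 a l0.
rewrite muleA -vol_cube_fineK// -EFinM.
apply: le_mule_ereal_inf; first by rewrite !mulr_gt0.
move=> _ [r [/= r0 hr] <-].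
move: hr; rewrite lee_pdivrMl// mule1 => hr.
have mQ := (vol_cube a l0).1.
rewrite -vol_cube_fineK// in hf.
apply: (le_trans (integral_normM_le_young hA mQ _ _ r0 K0 hr hf)).
- exact: measurable_funS mg.
- exact: measurable_funS mf.
- by rewrite -EFinD -!EFinM lee_fin le_eqVlt; apply/orP; left; apply/eqP; ring.
Qed.

(** The case g = 1, r = 1, where the modular of g is A(1) |Q|. *)
Lemma integral_norm_le_young_conj a l K f : 0 < l -> 0 < K ->
  measurable_fun setT f ->
  (\int[vol]_(y in cube a l) young_conj A (`|f y| / K) <= vol (cube a l))%E ->
  (\int[vol]_(y in cube a l) `|f y|%:E <= (K * (A 1 + 1))%:E * vol (cube a l))%E.
Proof.
move=> l0 K0 mf hf; have mQ := (vol_cube a l0).1.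
have h1 : (\int[vol]_(y in cube a l) (A (`|cst 1%R y| / 1))%:E <=
    (A 1 * fine (vol (cube a l)))%:E)%E.
  rewrite (eq_integral (cst (A 1)%:E)); last by move=> y _/=; rewrite normr1 divr1.
  by rewrite integral_cst//= -[in leLHS]vol_cube_fineK.
rewrite -vol_cube_fineK// in hf *.
have := integral_normM_le_young hA mQ (measurable_cst (1:R))
   (measurable_funS _ _ mf) ltr01 K0 h1 hf.
rewrite (eq_integral (fun y => `|f y|%:E)); last by move=> y _; rewrite mul1r.
move=> /(_ measurableT (@subsetT _ _)) /le_trans; apply.
by rewrite -EFinD -!EFinM lee_fin le_eqVlt; apply/orP; left; apply/eqP; ring.
Qed.

End cube_integrals.

(** * Cubes, dyadic annuli and Euclidean distance *)

Section geometry.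
Context {R : realType} {n : nat}.
Local Notation X := (Rn R n).
Implicit Types (x y a : X) (l e : R).

(** Borel sets are Lebesgue measurable, and coordinates are Borel. *)
Lemma measurable_pcoord (i : 'I_n) :
  measurable_fun (setT : set X) (fun x : X => pcoord x i).
Proof.
move=> _ Y mY; rewrite setTI.
apply: sub_caratheodory; apply: sub_sigma_algebra.
have := @measurable_tnth _ (measurableTypeR R) n i measurableT _ mY.
by rewrite setTI.
Qed.

Lemma measurable_eucl_dist x :
  measurable_fun (setT : set X) (fun y : X => eucl_dist x y).
Proof.
apply: (@measurableT_comp _ _ _ _ _ _ (@Num.sqrt R)).
  by apply: nondecreasing_measurable => // t u; exact: ler_wsqrtr.
apply: measurable_sum => i; apply: measurable_funX.
by apply: measurable_funB; [exact: measurable_cst|exact: measurable_pcoord].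
Qed.

Lemma measurable_eucl_far x e : measurable [set y | e < eucl_dist x y].
Proof.
have -> : [set y | e < eucl_dist x y] =
    setT `&` (fun y => eucl_dist x y) @^-1` `]e, +oo[%classic.
  by rewrite setTI; apply/seteqP; split => y /=; rewrite in_itv/= andbT.
by apply: measurable_eucl_dist => //; exact: measurable_itv.
Qed.

Lemma ler_pcoord_eucl_dist x y i : `|pcoord x i - pcoord y i| <= eucl_dist x y.
Proof.
rewrite -sqrtr_sqr ler_wsqrtr// (bigD1 i)//= lerDl.
by apply: sumr_ge0 => j _; exact: sqr_ge0.
Qed.

(** Some coordinate of y is further than l from that of the centre, while that of
    x is within l / 2. *)
Lemma eucl_dist_gt_cube a l e x y : cube a l x -> ~ cube a (2 * l) y ->
  e <= l / 2 -> e < eucl_dist x y.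
Proof.
move=> /= xQ /existsNP[i]; move=> /negP; rewrite -ltNge => yi el.
apply: lt_le_trans (ler_pcoord_eucl_dist x y i).
have xi := xQ i.
have : `|pcoord y i - pcoord a i| <=
    `|pcoord x i - pcoord a i| + `|pcoord x i - pcoord y i|.
  rewrite (_ : pcoord y i - pcoord a i =
    pcoord x i - pcoord a i - (pcoord x i - pcoord y i)); last by ring.
  exact: ler_normB.
lra.
Qed.

Lemma sub_cube a l l' : l <= l' -> cube a l `<=` cube a l'.
Proof.
by move=> ll' x xQ i; apply: (le_trans (xQ i)); rewrite ler_wpM2r.
Qed.

Lemma cube_exhaustion a l y : 0 < l -> exists m, cube a (2 ^+ m * l) y.
Proof.
move=> l0.
pose b := \sum_(i < n) `|pcoord y i - pcoord a i|.
have [m bm] : exists m, 2 * b / l < 2 ^+ m.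
  exists (Num.truncn (2 * b / l)).+1; rewrite (lt_le_trans (truncnS_gt _))//.
  by rewrite -natrX ler_nat ltnW// ltn_expl.
exists m => i; apply: (@le_trans _ _ b).
  by rewrite /b (bigD1 i)//= lerDl sumr_ge0.
by move: bm; rewrite ltr_pdivrMr// => bm; lra.
Qed.

(** A point outside the double cube lies in the annulus just below the least
    dyadic dilate that contains it. *)
Lemma cube_annuli a l : 0 < l ->
  ~` cube a (2 * l) =
  \bigcup_m (cube a (2 ^+ m.+2 * l) `\` cube a (2 ^+ m.+1 * l)).
Proof.
move=> l0; apply/seteqP; split => y; last first.
  move=> [m _ [_ yQ]] y2; apply: yQ; apply: sub_cube y2.
  by rewrite ler_pM2r// exprS ler_peMr// exprn_ege1// ler1n.
move=> y2; have ex : exists m, `[< cube a (2 ^+ m * l) y >].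
  by have [m ym] := cube_exhaustion a y l0; exists m; exact/asboolP.
case: (ex_minnP ex) => -[|[|m]] /asboolP ym mmin.
- exfalso; apply: y2; apply: sub_cube ym.
  by rewrite expr0 ler_pM2r// ler1n.
- by exfalso; apply: y2.
- exists m => //; split => // ym1; have := mmin m.+1.
  by rewrite ltnn => /(_ (asboolT ym1)).
Qed.

Lemma trivIset_annuli a l : 0 < l ->
  trivIset setT (fun m => cube a (2 ^+ m.+2 * l) `\` cube a (2 ^+ m.+1 * l)).
Proof.
move=> l0; have sub m k y : (m < k)%N ->
    cube a (2 ^+ m.+2 * l) y -> cube a (2 ^+ k.+1 * l) y.
  by move=> mk; apply: sub_cube; rewrite ler_pM2r// ler_weXn2l// ler1n.
apply/trivIsetP => i j _ _; rewrite neq_ltn => /orP[ij|ji];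
  apply/seteqP; split => // y [[yi nyi] [yj nyj]].
- by apply: nyj; exact: sub yi.
- by apply: nyi; exact: sub yj.
Qed.

End geometry.

(** * The far part *)

(** Hoelder's inequality on each dyadic annulus, after extending the factor h by
    zero from the annulus to the whole cube. *)
Lemma integral_kernel_diff_le (R : realType) (n : nat) (A : R -> R)
    (f h : Rn R n -> R) (a : Rn R n) (l K : R) : conditionC A ->
  0 < l -> 0 < K -> measurable_fun setT h -> measurable_fun setT f ->
  (forall L, 1 <= L ->
    (\int[vol]_(y in cube a (L * l)) young_conj A (`|f y| / K) <=
     vol (cube a (L * l)))%E) ->
  (\int[vol]_(y in ~` cube a (2 * l)) `|h y * f y|%:E <=
   (2 * K)%:E * \sum_(1 <= m <oo)
      vol (cube a (2 ^+ m.+1 * l)) *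
      luxemburg (EFin \o A) (cube a (2 ^+ m.+1 * l))
        (fun y => \1_(cube a (2 ^+ m.+1 * l) `\` cube a (2 ^+ m * l)) y *
                  h y)%R)%E.
Proof.
move=> hA l0 K0 mh mf hK.
have p0 m : 0 < 2 ^+ m * l by rewrite mulr_gt0// exprn_gt0.
have mQ m : measurable (cube a (2 ^+ m * l)) := (vol_cube a (p0 m)).1.
have mF m : measurable (cube a (2 ^+ m.+1 * l) `\` cube a (2 ^+ m * l)).
  exact: measurableD.
have mhf D : measurable_fun D (fun y => `|h y * f y|%:E).
  apply: (measurable_funS measurableT (@subsetT _ D)).
  apply/measurable_EFinP; apply: (measurableT_comp (@normr_measurable _ _)).
  exact: measurable_funM mh mf.
rewrite cube_annuli//.
rewrite ge0_integral_bigcup; last 4 first.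
- by move=> m; exact: mF.
- exact: mhf.
- by move=> y _; rewrite lee_fin.
- exact: trivIset_annuli.
rewrite -(nneseries_addn 1); last first.
  by move=> i; rewrite mule_ge0// luxemburg_ge0.
rewrite -nneseriesZl; last by move=> i _; rewrite mule_ge0// luxemburg_ge0.
apply: lee_nneseries => [m _ _|m _].
  by apply: integral_ge0 => y _; rewrite lee_fin.
rewrite addn1; set F := _ `\` _.
have FQ : F `<=` cube a (2 ^+ m.+2 * l) by move=> y [].
rewrite -[X in (integral _ X _ <= _)%E](setIidl FQ).
rewrite integral_mkcondl.
rewrite (eq_integral (fun y => `|(\1_F y * h y) * f y|%:E)); last first.
  move=> y _; rewrite patchE indicE; case: ifPn => _.
    by rewrite mul1r.
  by rewrite !mul0r normr0.
apply: (integral_normM_le_luxemburg hA (p0 _) K0 _ mf).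
- by apply: measurable_funM mh; apply: measurable_indic; exact: mF.
- by apply: hK; rewrite exprn_ege1 ?ler1n.
Qed.

(** Monotonicity and subadditivity are wanted for arbitrary sets, since the level
    sets of a principal value are not known to be measurable; they hold there
    because the volume is the outer measure. *)
Lemma vol_le (R : realType) (n : nat) : {homo @vol R n : B C / B `<=` C >-> (B <= C)%E}.
Proof. exact: (@le_mu_ext _ _ _ (borel_lebesgue R n)). Qed.

Lemma vol_setU_le (R : realType) (n : nat) (B C : set (Rn R n)) :
  (vol (B `|` C) <= vol B + vol C)%E.
Proof. exact: (outer_measureU2 (mu_ext (borel_lebesgue R n))). Qed.

Section splitting.
Context {R : realType} {n : nat}.
Local Notation X := (Rn R n).
Variables (k : X -> X -> R) (a : X) (l : R).
Hypothesis l0 : 0 < l.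
Implicit Types (f : X -> R) (u v : X).

Let mQ2 : measurable (cube a (2 * l)).
Proof. by apply: (vol_cube a _).1; rewrite mulr_gt0. Qed.

Let mQ2C : measurable (~` cube a (2 * l)).
Proof. exact: measurableC. Qed.

(** The complement of the double cube lies in the truncation domain of radius
    l / 2 around any point of the cube. *)
Lemma integrable_kernel_far f v : cube a l v -> pv_exists k f v ->
  vol.-integrable (~` cube a (2 * l)) (EFin \o (fun y => k v y * f y)).
Proof.
move=> vQ [fi _]; have l20 : 0 < l / 2 by rewrite divr_gt0.
apply: (integrableS (measurable_eucl_far v (l / 2)) mQ2C _ (fi _ l20)).
by move=> y /= yQ; exact: eucl_dist_gt_cube yQ _.
Qed.

(** Truncations at radius e <= l / 2 leave the complement of the double cube
    untouched, so near 0 the truncated integrals of f and of its restriction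
    differ by a number that does not depend on e. *)
Lemma pv_near_far f v : cube a l v -> pv_exists k f v ->
  pv_exists k (f \_ (cube a (2 * l))) v ->
  pv k f v = pv k (f \_ (cube a (2 * l))) v +
    \int[vol]_(y in ~` cube a (2 * l)) (k v y * f y).
Proof.
move=> vQ [fi _] [_ f1cvg]; rewrite /pv.
set f1 := f \_ _; set F := (\int[_]_(_ in _) _).
apply: cvg_lim => //.
have : truncated k f1 v e + F @[e --> 0^'+] -->
    lim (truncated k f1 v e @[e --> 0^'+]) + F.
  by apply: cvgD => //; exact: cvg_cst.
apply: cvg_trans; apply: near_eq_cvg; near=> e.
have e0 : 0 < e by near: e; exact: nbhs_right_gt.
have el : e <= l / 2 by near: e; apply: nbhs_right_le; rewrite divr_gt0.
rewrite /truncated; set E := [set y | _].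
have mE : measurable E := measurable_eucl_far v e.
have EE : E = (E `&` cube a (2 * l)) `|` ~` cube a (2 * l).
  rewrite setUIl setUv setIT setUidl// => y yQ.
  exact: eucl_dist_gt_cube yQ el.
have iE := fi _ e0; rewrite -/E in iE.
rewrite [X in _ = \int[_]_(_ in X) _]EE.
rewrite EE in iE.
rewrite Rintegral_setU; last 4 first.
- exact: measurableI.
- exact: mQ2C.
- exact: iE.
- by apply/disj_setPS => y [[_ ?]].
rewrite Rintegral_mkcondr; congr (_ + _).
apply: eq_Rintegral => y _; rewrite patchE.
by rewrite /f1 patchE; case: ifPn => // _; exact: mulr0.
Unshelve. all: by end_near. Qed.

Lemma kernel_far_diff_le f u v (b : R) : cube a l u -> cube a l v ->
  pv_exists k f u -> pv_exists k f v ->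
  (\int[vol]_(y in ~` cube a (2 * l)) `|(k u y - k v y) * f y|%:E <= b%:E)%E ->
  `|\int[vol]_(y in ~` cube a (2 * l)) (k u y * f y) -
    \int[vol]_(y in ~` cube a (2 * l)) (k v y * f y)| <= b.
Proof.
move=> uQ vQ fu fv hb.
have iu := integrable_kernel_far uQ fu.
have iv := integrable_kernel_far vQ fv.
have iB : vol.-integrable (~` cube a (2 * l))
    (EFin \o (fun y => k u y * f y - k v y * f y)).
  exact: (integrableB mQ2C iu iv).
rewrite -RintegralB; [|exact: mQ2C|exact: iu|exact: iv].
rewrite -lee_fin EFin_normr_Rintegral; [|exact: mQ2C|exact: iB].
apply: le_trans hb; apply: (le_trans (le_abse_integral _ mQ2C _)).
  exact: (measurable_int vol).
by rewrite le_eqVlt; apply/orP; left; apply/eqP; apply: eq_integral => y _ /=;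
  rewrite mulrBl.
Qed.

End splitting.

(** * The near part and the oscillation on one cube *)

Section oscillation.
Context {R : realType} {n : nat}.
Local Notation X := (Rn R n).
Variables (A : R -> R) (k : X -> X -> R).
Hypothesis hA : conditionC A.
Variables (s C cA : R).
Hypothesis s0 : 0 < s.
Hypothesis C0 : 0 < C.
Hypothesis mk : forall x, measurable_fun setT (k x).
Hypothesis pvL1 : forall f, vol.-integrable setT (EFin \o f) -> pv_defined k f.
Hypothesis weak : forall f, vol.-integrable setT (EFin \o f) ->
  forall t : R, 0 < t ->
    (vol [set x | (t < `|pv k f x|)%R] <=
     (C / t)%:E * \int[vol]_x `|f x|%:E)%E.
Hypothesis kerA : forall (a : X) (l : R), 0 < l ->
  forall u v, cube a l u -> cube a l v ->
  (\sum_(1 <= m <oo)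
     vol (cube a (2 ^+ m.+1 * l)) *
     luxemburg (EFin \o A) (cube a (2 ^+ m.+1 * l))
       (fun y => \1_(cube a (2 ^+ m.+1 * l) `\` cube a (2 ^+ m * l)) y *
                 (k u y - k v y))%R
   <= cA%:E)%E.

(** Height, in units of K, above which the weak type inequality leaves at most
    half of the allowed measure s |Q|; 2 ^+ n is |2Q| / |Q|. *)
Definition weak_level : R := 2 * C * (A 1 + 1) * 2 ^+ n / s.

Let A1_gt0 : 0 < A 1 + 1.
Proof. by rewrite ltr_wpDl// (conditionC_ge0 hA). Qed.

Lemma weak_level_gt0 : 0 < weak_level.
Proof. by rewrite divr_gt0// !mulr_gt0// exprn_gt0. Qed.

Lemma integral_norm_restrict_cube (f : X -> R) (a : X) (l : R) :
  (\int[vol]_y `|(f \_ (cube a l)) y|%:E = \int[vol]_(y in cube a l) `|f y|%:E)%E.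
Proof.
rewrite [RHS]integral_mkcond; apply: eq_integral => y _.
by rewrite !patchE; case: ifPn => // _; exact: (congr1 EFin (normr0 _)).
Qed.

Lemma integrable_restrict_cube (f : X -> R) (a : X) (l K : R) : 0 < l ->
  0 < K -> measurable_fun setT f ->
  (\int[vol]_(y in cube a l) young_conj A (`|f y| / K) <= vol (cube a l))%E ->
  vol.-integrable setT (EFin \o (f \_ (cube a l))).
Proof.
move=> l0 K0 mf hK; apply/integrableP; split.
  apply/measurable_EFinP; apply/(measurable_restrictT _ _).1.
    exact: (vol_cube a l0).1.
  exact: (measurable_funS measurableT (@subsetT _ _) mf).
rewrite [ltLHS](integral_norm_restrict_cube f a l).
apply: (le_lt_trans (integral_norm_le_young_conj hA l0 K0 mf hK)).
by rewrite (vol_cube a l0).2 ltry.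
Qed.

Lemma weak_type_near_part (f : X -> R) (a : X) (l K : R) : 0 < l -> 0 < K ->
  measurable_fun setT f ->
  (\int[vol]_(y in cube a (2 * l)) young_conj A (`|f y| / K) <=
   vol (cube a (2 * l)))%E ->
  (vol [set x | (weak_level * K < `|pv k (f \_ (cube a (2 * l))) x|)%R] <
   s%:E * vol (cube a l))%E.
Proof.
move=> l0 K0 mf hK; have l20 : 0 < 2 * l by rewrite mulr_gt0.
have t0 : 0 < weak_level * K by rewrite mulr_gt0 ?weak_level_gt0.
apply: (le_lt_trans (weak (integrable_restrict_cube l20 K0 mf hK) t0)).
rewrite integral_norm_restrict_cube.
apply: (@le_lt_trans _ _
    ((C / (weak_level * K))%:E * ((K * (A 1 + 1))%:E * vol (cube a (2 * l))))%E).
  apply: lee_wpmul2l; first by rewrite lee_fin divr_ge0// ltW.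
  exact: integral_norm_le_young_conj.
rewrite (vol_cube a l20).2 (vol_cube a l0).2 -!EFinM lte_fin exprMn.
have -> : C / (weak_level * K) * (K * (A 1 + 1) * (2 ^+ n * l ^+ n)) =
    s * l ^+ n / 2.
  by rewrite /weak_level; field; rewrite !gt_eqF//= exprn_gt0.
by rewrite gtr_pMr ?mulr_gt0 ?exprn_gt0// invf_lt1// ltr1n.
Qed.

(** The constant is the far integral at a point u where both principal values
    exist; such a point is found because the exceptional set is null and the
    cube is not. *)
Lemma oscillation_lt (f : X -> R) (a : X) (l K : R) : 0 < l -> 0 < K ->
  0 <= cA -> pv_defined k f ->
  (forall L, 1 <= L ->
    (\int[vol]_(y in cube a (L * l)) young_conj A (`|f y| / K) <=
     vol (cube a (L * l)))%E) ->
  exists c : R,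
    (vol (cube a l `&`
      [set y | ((weak_level + 2 * cA) * K < `|pv k f y - c|)%R]) <
     s%:E * vol (cube a l))%E.
Proof.
move=> l0 K0 cA0 [mf pvf] hK; have l20 : 0 < 2 * l by rewrite mulr_gt0.
have hK2 := hK 2 (ler1n _ 2).
set f1 := f \_ (cube a (2 * l)).
have [_ pvf1] := pvL1 (integrable_restrict_cube l20 K0 mf hK2).
have [N [mN N0 badN]] : {ae vol, forall x, pv_exists k f x /\ pv_exists k f1 x}.
  exact: filterI pvf pvf1.
have good v : ~ N v -> pv_exists k f v /\ pv_exists k f1 v.
  by move=> Nv; apply: contrapT => bad; apply: Nv; exact: badN.
have [u [uQ Nu]] : exists u, cube a l u /\ ~ N u.
  apply: contrapT => /forallNP H.
  have : cube a l `<=` N by move=> u uQ; apply: contrapT => Nu; exact: (H u).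
  move=> /(@vol_le R n); apply/negP; rewrite N0 -ltNge (vol_cube a l0).2.
  by rewrite lte_fin exprn_gt0.
have [fu _] := good _ Nu.
pose F v := \int[vol]_(y in ~` cube a (2 * l)) (k v y * f y).
exists (F u).
apply: (@le_lt_trans _ _ (vol (N `|` [set x | (weak_level * K < `|pv k f1 x|)%R]))).
  apply: vol_le => v [vQ /= big].
  have [Nv|/good[fv f1v]] := pselect (N v); [by left|right => /=].
  move: big; rewrite (pv_near_far l0 vQ fv f1v) -/(F v) -/f1.
  have FF : `|F v - F u| <= 2 * K * cA.
    apply: (kernel_far_diff_le l0 vQ uQ fv fu).
    have mh : measurable_fun setT (fun y => k v y - k u y).
      exact: measurable_funB.
    apply: (le_trans (integral_kernel_diff_le hA l0 K0 mh mf hK)).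
    rewrite (EFinM (2 * K) cA); apply: lee_wpmul2l.
      by rewrite lee_fin mulr_ge0// ltW.
    exact: kerA.
  have := ler_normD (pv k f1 v) (F v - F u); rewrite addrA; lra.
apply: (le_lt_trans (vol_setU_le _ _)); rewrite [X in (X + _)%E]N0 add0e.
exact: weak_type_near_part.
Qed.

End oscillation.

(** * From one cube to the local sharp maximal function *)

Lemma luxemburg_le_maximal (R : realType) (n : nat) (B : R -> \bar R)
    (a y : Rn R n) (l : R) (f : Rn R n -> R) : 0 < l -> cube a l y ->
  (luxemburg B (cube a l) f <= maximal B f y)%E.
Proof.
move=> l0 yQ; apply: ereal_sup_ubound; exists (cube a l) => //.
by split => //; exists a, l.
Qed.

Theorem theorem4p3 (R : realType) (n : nat) (hn : (0 < n)%N)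
    (s : R) (hs0 : 0 < s) (hs : s <= 1 / 2)
    (A : R -> R) (hA : young A)
    (k : Rn R n -> Rn R n -> R)
    (hT : singular_integral_weak11 k)
    (hk : kernel_condition A k) :
  exists c : R, 0 < c /\
    forall f : Rn R n -> R, pv_defined k f ->
    forall Q0 : set (Rn R n), is_cube Q0 ->
    forall x, Q0 x ->
      (local_sharp s Q0 (pv k f) x <=
       c%:E * ereal_sup [set ereal_inf [set maximal (young_conj A) f y | y in Q]
                        | Q in [set Q | [/\ is_cube Q, Q x & Q `<=` Q0]]])%E.
Proof.
have [cC _] := hA; have [mk pvL1 [C0 weak0]] := hT; have [cA0 kerA0] := hk.
(* The given constants carry no sign, so they are enlarged. *)
pose C := Num.max C0 1; pose cA := Num.max cA0 0.
have C_gt0 : 0 < C by rewrite lt_max ltr01 orbT.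
have cA_ge0 : 0 <= cA by rewrite le_max lexx orbT.
have cA0A : (cA0%:E <= cA%:E)%E by rewrite lee_fin le_max lexx.
have weak f : vol.-integrable setT (EFin \o f) -> forall t : R, 0 < t ->
    (vol [set x | (t < `|pv k f x|)%R] <=
     (C / t)%:E * \int[vol]_x `|f x|%:E)%E.
  move=> fi t t0; apply: (le_trans (weak0 f fi t t0)).
  apply: lee_wpmul2r; first by apply: integral_ge0 => y _; rewrite lee_fin.
  by rewrite lee_fin ler_wpM2r ?invr_ge0 ?(ltW t0)// le_max lexx.
have kerA (a : Rn R n) (l : R) : 0 < l ->
    forall u v, cube a l u -> cube a l v -> (_ <= cA%:E)%E :=
  fun l0 u v uQ vQ => le_trans (kerA0 a l l0 u v uQ vQ) cA0A.
pose c := @weak_level R n A s C + 2 * cA.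
have c0 : 0 < c.
  by rewrite ltr_wpDr ?mulr_ge0//; exact: weak_level_gt0.
exists c; split => // f pvf Q0 _ x _.
apply/ereal_supP => _ [Q [[a [l [l0 ->]]] xQ QQ0] <-].
apply: (@le_trans _ _
    (c%:E * ereal_inf [set maximal (young_conj A) f y | y in cube a l])%E); last first.
  apply: lee_wpmul2l; first by rewrite lee_fin ltW.
  apply: ereal_sup_ubound; exists (cube a l) => //.
  by split => //; exists a, l.
apply: le_mule_ereal_inf => // _ [y yQ <-].
have M0 : (0 <= maximal (young_conj A) f y)%E.
  exact: le_trans (luxemburg_ge0 _ _ _) (luxemburg_le_maximal _ f l0 yQ).
have luxM L : 0 < L * l -> cube a (L * l) y ->
    (luxemburg (young_conj A) (cube a (L * l)) f <= maximal (young_conj A) f y)%E.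
  exact: luxemburg_le_maximal.
move: M0 luxM; case: (maximal _ _ _) => [m| |//] m0 luxm; last first.
  by rewrite gt0_muley ?lte_fin// leey.
(* K must exceed the maximal function strictly, and be positive even where the
   maximal function vanishes; the slack costs c * (e / c) = e. *)
apply/lee_addgt0Pr => e e0.
pose K := m + e / c.
have K0 : 0 < K by rewrite ltr_wpDl// divr_gt0.
have hK L : 1 <= L ->
    (\int[vol]_(y in cube a (L * l)) young_conj A (`|f y| / K) <=
     vol (cube a (L * l)))%E.
  move=> L1; have Ll0 : 0 < L * l by rewrite mulr_gt0// (lt_le_trans ltr01).
  apply: (lt_luxemburg_young_conj cC Ll0 pvf.1).
  apply: (@le_lt_trans _ _ m%:E); last by rewrite lte_fin ltrDl divr_gt0.
  apply: luxm => //; apply: sub_cube yQ.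
  by rewrite ler_peMl// ltW.
have [c1 hc1] := oscillation_lt cC hs0 C_gt0 mk pvL1 weak kerA l0 K0 cA_ge0 pvf hK.
apply: ge_ereal_inf; eexists; first by exists c1.
apply: ge_ereal_inf; exists (c * K)%:E.
  by exists (c * K) => //; split => //; rewrite mulr_ge0// ltW.
by rewrite -EFinM -EFinD lee_fin /K mulrDr mulrCA divff ?mulr1// gt_eqF.
Qed.
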